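(* Let $F$ be the free rack on one element. Then for all racks $R$, there are natural isomorphisms of racks $R\otimes F\cong R\cong F\otimes R$. Similarly, let $L$ be the free GL-rack on one element. Then for all GL-racks $R$, there are natural isomorphisms of GL-racks $R\otimes L\cong R\cong L\otimes R$.
   Context: A rack is a pair $(X,s)$ of a set $X$ and a map $s:X\to S_X$, $x\mapsto s_x$ ($S_X$ the group of permutations of $X$), such that $s_xs_y=s_{s_x(y)}s_x$ for all $x,y\in X$. A rack homomorphism $(X,s)\to(Y,t)$ is a map $\varphi:X\to Y$ with $\varphi s_x=t_{\varphi(x)}\varphi$ for all $x\in X$. A GL-structure on $R=(X,s)$ is a rack automorphism $\mathtt{u}$ of $R$ with $\mathtt{u}s_x=s_x\mathtt{u}$ for all $x\in X$; $(R,\mathtt{u})$ is then a GL-rack. A GL-rack homomorphism $(R_1,\mathtt{u}_1)\to(R_2,\mathtt{u}_2)$ is a rack homomorphism $\varphi$ with $\varphi\mathtt{u}_1=\mathtt{u}_2\varphi$. Racks form an algebraic theory with binary operations $s_-(-)$, $s^{-1}_-(-)$; GL-racks have additionally unary operations $\mathtt{u},\mathtt{u}^{-1}$. The free rack $\operatorname{Free}_{\mathsf{Rack}}(Z)$ and the free GL-rack $\operatorname{Free}_{\mathsf{GLR}}(Z)$ on a set $Z$ are the free objects in the usual universal-property sense; congruences are equivalence relations compatible with all operations. Tensor product of racks: for racks $R_1=(X,r)$, $R_2=(Y,t)$, $R_1\otimes R_2$ is $\operatorname{Free}_{\mathsf{Rack}}(X\times Y)$ (with rack structure $s$, and generators $x\otimes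 y:=(x,y)$) modulo the smallest congruence such that for all $x,x_1,x_2\in X$ and $y,y_1,y_2\in Y$: (T1) $s_{x\otimes y_2}(x\otimes y_1)\sim x\otimes t_{y_2}(y_1)$ and $s^{-1}_{x\otimes y_2}(x\otimes y_1)\sim x\otimes t^{-1}_{y_2}(y_1)$; (T2) $s_{x_2\otimes y}(x_1\otimes y)\sim r_{x_2}(x_1)\otimes y$ and $s^{-1}_{x_2\otimes y}(x_1\otimes y)\sim r^{-1}_{x_2}(x_1)\otimes y$. Tensor product of GL-racks: for GL-racks $(X,r,\mathtt{u}_1)$, $(Y,t,\mathtt{u}_2)$, it is $\operatorname{Free}_{\mathsf{GLR}}(X\times Y)$ modulo the smallest congruence such that (T1), (T2) and (T3) $\mathtt{u}(x\otimes y)\sim\mathtt{u}_1(x)\otimes y\sim x\otimes\mathtt{u}_2(y)$ hold for all such elements. *)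

(* Defs.v *)
From HB Require Import structures.
From mathcomp Require Import all_boot.
From mathcomp Require Import boolp.

Set Implicit Arguments.
Unset Strict Implicit.
Unset Printing Implicit Defensive.

Local Open Scope quotient_scope.

(** [act x y] is s_x(y) and [actV x y] is s_x^{-1}(y).  The operations are
    separated from the identities they satisfy because free objects are
    built as quotients of term algebras, which are not racks themselves. *)

HB.mixin Record hasRackOps (X : Type) := {
  act : X -> X -> X;
  actV : X -> X -> X }.
#[short(type="rackAlgType")]
HB.structure Definition RackAlg := {X of hasRackOps X}.

(* [actK] and [actVK] say that s_x is a permutation with inverse [actV x]. *)
HB.mixin Record RackAlg_isRack X of RackAlg X := {
  actK : forall x : X, cancel (act x) (actV x);
  actVK : forall x : X, cancel (actV x) (act x);
  act_act : forall x y z : X, act x (act y z) = act (act x y) (act x z) }.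
#[short(type="rackType")]
HB.structure Definition Rack := {X of RackAlg X & RackAlg_isRack X}.

HB.mixin Record hasGLOps (X : Type) := {
  glu : X -> X;
  gluV : X -> X }.
#[short(type="glAlgType")]
HB.structure Definition GLAlg := {X of RackAlg X & hasGLOps X}.

(* [glu] is a rack automorphism ([gluK], [gluVK], [glu_hom]) that commutes
   with every s_x ([glu_act]). *)
HB.mixin Record GLAlg_isGLRack X of GLAlg X := {
  gluK : cancel (glu : X -> X) gluV;
  gluVK : cancel (gluV : X -> X) glu;
  glu_hom : forall x y : X, glu (act x y) = act (glu x) (glu y);
  glu_act : forall x y : X, glu (act x y) = act x (glu y) }.
#[short(type="glRackType")]
HB.structure Definition GLRack := {X of Rack X & GLAlg X & GLAlg_isGLRack X}.

HB.mixin Record isRackHom (R S : rackType) (f : R -> S) := {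
  hom_act : forall x y : R, f (act x y) = act (f x) (f y) }.
HB.structure Definition RackHom (R S : rackType) := {f of isRackHom R S f}.
Notation "{ 'rackhom' R -> S }" := (RackHom.type R S)
  (at level 0, R at level 98, S at level 99,
   format "{ 'rackhom'  R  ->  S }") : type_scope.

HB.mixin Record isGLHom (R S : glRackType) (f : R -> S) := {
  hom_glu : forall x : R, f (glu x) = glu (f x) }.
HB.structure Definition GLHom (R S : glRackType) :=
  {f of isRackHom R S f & isGLHom R S f}.
Notation "{ 'glhom' R -> S }" := (GLHom.type R S)
  (at level 0, R at level 98, S at level 99,
   format "{ 'glhom'  R  ->  S }") : type_scope.

HB.instance Definition _ (R : rackType) :=
  isRackHom.Build R R idfun (fun _ _ => erefl).
HB.instance Definition _ (R : glRackType) :=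
  isGLHom.Build R R idfun (fun _ => erefl).

Definition mk_rackhom (R S : rackType) (f : R -> S)
    (fA : forall x y, f (act x y) = act (f x) (f y)) : {rackhom R -> S} :=
  HB.pack f (isRackHom.Build R S f fA).

Definition mk_glhom (R S : glRackType) (f : R -> S)
    (fA : forall x y, f (act x y) = act (f x) (f y))
    (fu : forall x, f (glu x) = glu (f x)) : {glhom R -> S} :=
  HB.pack f (isRackHom.Build R S f fA) (isGLHom.Build R S f fu).

Lemma hom_actV (R S : rackType) (f : {rackhom R -> S}) (x y : R) :
  f (actV x y) = actV (f x) (f y).
Proof. by rewrite -[RHS]/(actV (f x) (f y)) -{2}[y](actVK x) hom_act actK. Qed.

Lemma hom_gluV (R S : glRackType) (f : {glhom R -> S}) (x : R) :
  f (gluV x) = gluV (f x).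
Proof. by rewrite -{2}[x]gluVK hom_glu gluK. Qed.

Lemma glhom_act (R S : glRackType) (f : {glhom R -> S}) (x y : R) :
  f (act x y) = act (f x) (f y).
Proof. exact: hom_act. Qed.

Lemma glhom_actV (R S : glRackType) (f : {glhom R -> S}) (x y : R) :
  f (actV x y) = actV (f x) (f y).
Proof. exact: hom_actV. Qed.

Definition rack_iso (R S : rackType) (f : {rackhom R -> S}) : Prop :=
  exists g : {rackhom S -> R}, cancel f g /\ cancel g f.

Definition gl_iso (R S : glRackType) (f : {glhom R -> S}) : Prop :=
  exists g : {glhom S -> R}, cancel f g /\ cancel g f.

Record equivalence (T : Type) (C : T -> T -> Prop) : Prop := Equivalence {
  equiv_refl : forall x, C x x;
  equiv_sym : forall x y, C x y -> C y x;
  equiv_trans : forall x y z, C x y -> C y z -> C x z }.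

Record rack_congruence (A : rackAlgType) (C : A -> A -> Prop) : Prop :=
  RackCongruence {
    rcgr_equiv :> equivalence C;
    rcgr_act : forall a a' b b', C a a' -> C b b' -> C (act a b) (act a' b');
    rcgr_actV : forall a a' b b',
      C a a' -> C b b' -> C (actV a b) (actV a' b') }.

Record gl_congruence (A : glAlgType) (C : A -> A -> Prop) : Prop :=
  GLCongruence {
    gcgr_rack :> rack_congruence C;
    gcgr_glu : forall a a', C a a' -> C (glu a) (glu a');
    gcgr_gluV : forall a a', C a a' -> C (gluV a) (gluV a') }.

Definition rack_cgr (A : rackAlgType) (E : A -> A -> Prop) (a b : A) : Prop :=
  forall C : A -> A -> Prop, rack_congruence C ->
    (forall x y, E x y -> C x y) -> C a b.

Definition gl_cgr (A : glAlgType) (E : A -> A -> Prop) (a b : A) : Prop :=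
  forall C : A -> A -> Prop, gl_congruence C ->
    (forall x y, E x y -> C x y) -> C a b.

Lemma rack_cgrP (A : rackAlgType) (E : A -> A -> Prop) :
  rack_congruence (rack_cgr E).
Proof.
split; first split.
- by move=> x C CC _; apply: (equiv_refl CC).
- by move=> x y xy C CC EC; apply: (equiv_sym CC (xy C CC EC)).
- by move=> x y z xy yz C CC EC;
  apply: (equiv_trans CC (xy C CC EC) (yz C CC EC)).
- by move=> a a' b b' aa bb C CC EC;
  apply: (rcgr_act CC (aa C CC EC) (bb C CC EC)).
- by move=> a a' b b' aa bb C CC EC;
  apply: (rcgr_actV CC (aa C CC EC) (bb C CC EC)).
Qed.

Lemma gl_cgrP (A : glAlgType) (E : A -> A -> Prop) : gl_congruence (gl_cgr E).
Proof.
split; first split; first split.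
- by move=> x C CC _; apply: (equiv_refl CC).
- by move=> x y xy C CC EC; apply: (equiv_sym CC (xy C CC EC)).
- by move=> x y z xy yz C CC EC;
  apply: (equiv_trans CC (xy C CC EC) (yz C CC EC)).
- by move=> a a' b b' aa bb C CC EC;
  apply: (rcgr_act CC (aa C CC EC) (bb C CC EC)).
- by move=> a a' b b' aa bb C CC EC;
  apply: (rcgr_actV CC (aa C CC EC) (bb C CC EC)).
- by move=> a a' aa C CC EC; apply: (gcgr_glu CC (aa C CC EC)).
- by move=> a a' aa C CC EC; apply: (gcgr_gluV CC (aa C CC EC)).
Qed.

Lemma sub_rack_cgr (A : rackAlgType) (E : A -> A -> Prop) (a b : A) :
  E a b -> rack_cgr E a b.
Proof. by move=> Eab C _; apply. Qed.

Lemma sub_gl_cgr (A : glAlgType) (E : A -> A -> Prop) (a b : A) :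
  E a b -> gl_cgr E a b.
Proof. by move=> Eab C _; apply. Qed.

Definition classic_rel (T : Type) (C : T -> T -> Prop) : rel {classic T} :=
  fun x y => `[< C x y >].

Lemma classic_relP (T : Type) (C : T -> T -> Prop) :
  equivalence C -> equiv_class_of (classic_rel C).
Proof.
case=> Cr Cs Ct; split.
- by move=> x; apply/asboolP.
- by move=> x y; apply/asboolP/asboolP; apply: Cs.
- by move=> y x z /asboolP xy /asboolP yz; apply/asboolP; apply: Ct yz.
Qed.

Definition equiv_quot (T : Type) (C : T -> T -> Prop) (eC : equivalence C) :
    Type :=
  {eq_quot EquivRelPack (classic_relP eC)}.

Definition qpi (T : Type) (C : T -> T -> Prop) (eC : equivalence C) (x : T) :
    equiv_quot eC :=
  \pi_({eq_quot EquivRelPack (classic_relP eC)}) (x : {classic T}).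

Definition qrepr (T : Type) (C : T -> T -> Prop) (eC : equivalence C)
    (q : equiv_quot eC) : T :=
  repr (q : {eq_quot EquivRelPack (classic_relP eC)}).

Lemma qreprK (T : Type) (C : T -> T -> Prop) (eC : equivalence C) :
  cancel (@qrepr T C eC) (@qpi T C eC).
Proof. by move=> q; apply: reprK. Qed.

Lemma qpiP (T : Type) (C : T -> T -> Prop) (eC : equivalence C) (x y : T) :
  qpi eC x = qpi eC y <-> C x y.
Proof.
split.
- by move/eqmodP => /= /asboolP.
- by move=> Cxy; apply/eqmodP => /=; apply/asboolP.
Qed.

Lemma qrepr_pi (T : Type) (C : T -> T -> Prop) (eC : equivalence C) (x : T) :
  C (qrepr (qpi eC x)) x.
Proof. by apply/(qpiP eC); rewrite qreprK. Qed.

(* A / <E>, with <E> the smallest congruence containing E. *)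
Definition rack_quot (A : rackAlgType) (E : A -> A -> Prop) : Type :=
  equiv_quot (rcgr_equiv (rack_cgrP E)).
Definition rack_pi (A : rackAlgType) (E : A -> A -> Prop) (a : A) :
    rack_quot E :=
  qpi _ a.

Definition rack_quot_act (A : rackAlgType) (E : A -> A -> Prop)
    (p q : rack_quot E) : rack_quot E :=
  rack_pi E (act (qrepr p) (qrepr q)).
Definition rack_quot_actV (A : rackAlgType) (E : A -> A -> Prop)
    (p q : rack_quot E) : rack_quot E :=
  rack_pi E (actV (qrepr p) (qrepr q)).

HB.instance Definition _ (A : rackAlgType) (E : A -> A -> Prop) :=
  hasRackOps.Build (rack_quot E) (@rack_quot_act A E) (@rack_quot_actV A E).

Definition gl_quot (A : glAlgType) (E : A -> A -> Prop) : Type :=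
  equiv_quot (rcgr_equiv (gl_cgrP E)).
Definition gl_pi (A : glAlgType) (E : A -> A -> Prop) (a : A) : gl_quot E :=
  qpi _ a.

Definition gl_quot_act (A : glAlgType) (E : A -> A -> Prop)
    (p q : gl_quot E) : gl_quot E :=
  gl_pi E (act (qrepr p) (qrepr q)).
Definition gl_quot_actV (A : glAlgType) (E : A -> A -> Prop)
    (p q : gl_quot E) : gl_quot E :=
  gl_pi E (actV (qrepr p) (qrepr q)).
Definition gl_quot_glu (A : glAlgType) (E : A -> A -> Prop)
    (p : gl_quot E) : gl_quot E :=
  gl_pi E (glu (qrepr p)).
Definition gl_quot_gluV (A : glAlgType) (E : A -> A -> Prop)
    (p : gl_quot E) : gl_quot E :=
  gl_pi E (gluV (qrepr p)).

HB.instance Definition _ (A : glAlgType) (E : A -> A -> Prop) :=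
  hasRackOps.Build (gl_quot E) (@gl_quot_act A E) (@gl_quot_actV A E).
HB.instance Definition _ (A : glAlgType) (E : A -> A -> Prop) :=
  hasGLOps.Build (gl_quot E) (@gl_quot_glu A E) (@gl_quot_gluV A E).

Lemma rack_piP (A : rackAlgType) (E : A -> A -> Prop) (a b : A) :
  rack_pi E a = rack_pi E b <-> rack_cgr E a b.
Proof. exact: qpiP. Qed.

Lemma rack_pi_surj (A : rackAlgType) (E : A -> A -> Prop) (q : rack_quot E) :
  exists a, q = rack_pi E a.
Proof. by exists (qrepr q); rewrite /rack_pi qreprK. Qed.

Lemma rack_pi_act (A : rackAlgType) (E : A -> A -> Prop) (a b : A) :
  rack_pi E (act a b) = act (rack_pi E a) (rack_pi E b).
Proof.
apply/esym/rack_piP; apply: (rcgr_act (rack_cgrP E));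
  exact: (qrepr_pi (rcgr_equiv (rack_cgrP E))).
Qed.

Lemma rack_pi_actV (A : rackAlgType) (E : A -> A -> Prop) (a b : A) :
  rack_pi E (actV a b) = actV (rack_pi E a) (rack_pi E b).
Proof.
apply/esym/rack_piP; apply: (rcgr_actV (rack_cgrP E));
  exact: (qrepr_pi (rcgr_equiv (rack_cgrP E))).
Qed.

Lemma gl_piP (A : glAlgType) (E : A -> A -> Prop) (a b : A) :
  gl_pi E a = gl_pi E b <-> gl_cgr E a b.
Proof. exact: qpiP. Qed.

Lemma gl_pi_surj (A : glAlgType) (E : A -> A -> Prop) (q : gl_quot E) :
  exists a, q = gl_pi E a.
Proof. by exists (qrepr q); rewrite /gl_pi qreprK. Qed.

Lemma gl_pi_act (A : glAlgType) (E : A -> A -> Prop) (a b : A) :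
  gl_pi E (act a b) = act (gl_pi E a) (gl_pi E b).
Proof.
apply/esym/gl_piP; apply: (rcgr_act (gl_cgrP E));
  exact: (qrepr_pi (rcgr_equiv (gl_cgrP E))).
Qed.

Lemma gl_pi_actV (A : glAlgType) (E : A -> A -> Prop) (a b : A) :
  gl_pi E (actV a b) = actV (gl_pi E a) (gl_pi E b).
Proof.
apply/esym/gl_piP; apply: (rcgr_actV (gl_cgrP E));
  exact: (qrepr_pi (rcgr_equiv (gl_cgrP E))).
Qed.

Lemma gl_pi_glu (A : glAlgType) (E : A -> A -> Prop) (a : A) :
  gl_pi E (glu a) = glu (gl_pi E a).
Proof.
apply/esym/gl_piP; apply: (gcgr_glu (gl_cgrP E));
  exact: (qrepr_pi (rcgr_equiv (gl_cgrP E))).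
Qed.

Lemma gl_pi_gluV (A : glAlgType) (E : A -> A -> Prop) (a : A) :
  gl_pi E (gluV a) = gluV (gl_pi E a).
Proof.
apply/esym/gl_piP; apply: (gcgr_gluV (gl_cgrP E));
  exact: (qrepr_pi (rcgr_equiv (gl_cgrP E))).
Qed.

Lemma rack_cgr_sub_ker (A : rackAlgType) (E : A -> A -> Prop) (R : rackType)
    (f : A -> R) :
    (forall a b, f (act a b) = act (f a) (f b)) ->
    (forall a b, f (actV a b) = actV (f a) (f b)) ->
    (forall a b, E a b -> f a = f b) ->
  forall a b, rack_cgr E a b -> f a = f b.
Proof.
move=> fA fV fE a b /(_ (fun x y => f x = f y)); apply=> //.
split; first by split=> [//|x y ->|x y z -> ->].
- by move=> x x' y y' xx yy; rewrite !fA xx yy.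
- by move=> x x' y y' xx yy; rewrite !fV xx yy.
Qed.

Lemma gl_cgr_sub_ker (A : glAlgType) (E : A -> A -> Prop) (R : glRackType)
    (f : A -> R) :
    (forall a b, f (act a b) = act (f a) (f b)) ->
    (forall a b, f (actV a b) = actV (f a) (f b)) ->
    (forall a, f (glu a) = glu (f a)) ->
    (forall a, f (gluV a) = gluV (f a)) ->
    (forall a b, E a b -> f a = f b) ->
  forall a b, gl_cgr E a b -> f a = f b.
Proof.
move=> fA fV fu fuV fE a b /(_ (fun x y => f x = f y)); apply=> //.
split; first split; first by split=> [//|x y ->|x y z -> ->].
- by move=> x x' y y' xx yy; rewrite !fA xx yy.
- by move=> x x' y y' xx yy; rewrite !fV xx yy.
- by move=> x x' xx; rewrite !fu xx.
- by move=> x x' xx; rewrite !fuV xx.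
Qed.

Definition is_free_rack (Z : Type) (F : rackType) (i : Z -> F) : Prop :=
  forall (R : rackType) (f : Z -> R),
    exists g : {rackhom F -> R}, (forall z, g (i z) = f z) /\
      forall h : {rackhom F -> R}, (forall z, h (i z) = f z) -> h =1 g.

Definition is_free_gl (Z : Type) (L : glRackType) (i : Z -> L) : Prop :=
  forall (R : glRackType) (f : Z -> R),
    exists g : {glhom L -> R}, (forall z, g (i z) = f z) /\
      forall h : {glhom L -> R}, (forall z, h (i z) = f z) -> h =1 g.

Inductive rack_term (Z : Type) : Type :=
| RGen of Z
| RAct of rack_term Z & rack_term Z
| RActV of rack_term Z & rack_term Z.

HB.instance Definition _ (Z : Type) :=
  hasRackOps.Build (rack_term Z) (@RAct Z) (@RActV Z).

Inductive rack_identity (A : rackAlgType) : A -> A -> Prop :=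
| RI_actK a b : rack_identity (actV a (act a b)) b
| RI_actVK a b : rack_identity (act a (actV a b)) b
| RI_act_act a b c :
    rack_identity (act a (act b c)) (act (act a b) (act a c)).

Inductive gl_identity (A : glAlgType) : A -> A -> Prop :=
| GI_rack a b : rack_identity a b -> gl_identity a b
| GI_gluK a : gl_identity (gluV (glu a)) a
| GI_gluVK a : gl_identity (glu (gluV a)) a
| GI_glu_hom a b : gl_identity (glu (act a b)) (act (glu a) (glu b))
| GI_glu_act a b : gl_identity (glu (act a b)) (act a (glu b)).

Lemma rack_quot_isRack (A : rackAlgType) (E : A -> A -> Prop) :
    (forall a b, rack_identity a b -> rack_cgr E a b) ->
  RackAlg_isRack (rack_quot E).
Proof.
move=> IE; split.
- move=> p q; have [[a ->] [b ->]] := (rack_pi_surj p, rack_pi_surj q).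
  by rewrite -rack_pi_act -rack_pi_actV; apply/rack_piP; apply: IE;
    exact: RI_actK.
- move=> p q; have [[a ->] [b ->]] := (rack_pi_surj p, rack_pi_surj q).
  by rewrite -rack_pi_actV -rack_pi_act; apply/rack_piP; apply: IE;
    exact: RI_actVK.
- move=> p q r; have [[a ->] [b ->]] := (rack_pi_surj p, rack_pi_surj q).
  have [c ->] := rack_pi_surj r.
  rewrite -(rack_pi_act _ b c) -(rack_pi_act _ a b) -(rack_pi_act _ a c).
  rewrite -(rack_pi_act _ a (act b c)) -(rack_pi_act _ (act a b) (act a c)).
  by apply/rack_piP; apply: IE; exact: RI_act_act.
Qed.

Lemma gl_quot_isRack (A : glAlgType) (E : A -> A -> Prop) :
    (forall a b, gl_identity a b -> gl_cgr E a b) ->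
  RackAlg_isRack (gl_quot E).
Proof.
move=> IE; split.
- move=> p q; have [[a ->] [b ->]] := (gl_pi_surj p, gl_pi_surj q).
  rewrite -gl_pi_act -gl_pi_actV.
  by apply/gl_piP; apply: IE; apply: GI_rack; exact: RI_actK.
- move=> p q; have [[a ->] [b ->]] := (gl_pi_surj p, gl_pi_surj q).
  rewrite -gl_pi_actV -gl_pi_act.
  by apply/gl_piP; apply: IE; apply: GI_rack; exact: RI_actVK.
- move=> p q r; have [[a ->] [b ->]] := (gl_pi_surj p, gl_pi_surj q).
  have [c ->] := gl_pi_surj r.
  rewrite -(gl_pi_act _ b c) -(gl_pi_act _ a b) -(gl_pi_act _ a c).
  rewrite -(gl_pi_act _ a (act b c)) -(gl_pi_act _ (act a b) (act a c)).
  by apply/gl_piP; apply: IE; apply: GI_rack; exact: RI_act_act.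
Qed.

Lemma gl_quot_isGLRack (A : glAlgType) (E : A -> A -> Prop) :
    (forall a b, gl_identity a b -> gl_cgr E a b) ->
  GLAlg_isGLRack (gl_quot E).
Proof.
move=> IE; split.
- move=> p; have [a ->] := gl_pi_surj p.
  by rewrite -gl_pi_glu -gl_pi_gluV; apply/gl_piP; apply: IE; exact: GI_gluK.
- move=> p; have [a ->] := gl_pi_surj p.
  by rewrite -gl_pi_gluV -gl_pi_glu; apply/gl_piP; apply: IE; exact: GI_gluVK.
- move=> p q; have [[a ->] [b ->]] := (gl_pi_surj p, gl_pi_surj q).
  rewrite -gl_pi_act -(gl_pi_glu _ (act a b)) -(gl_pi_glu _ a) -(gl_pi_glu _ b)
    -(gl_pi_act _ (glu a) (glu b)).
  by apply/gl_piP; apply: IE; exact: GI_glu_hom.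
- move=> p q; have [[a ->] [b ->]] := (gl_pi_surj p, gl_pi_surj q).
  rewrite -gl_pi_act -(gl_pi_glu _ (act a b)) -(gl_pi_glu _ b)
    -(gl_pi_act _ a (glu b)).
  by apply/gl_piP; apply: IE; exact: GI_glu_act.
Qed.

Definition free_rack (Z : Type) : Type :=
  rack_quot (@rack_identity (rack_term Z)).
HB.instance Definition _ (Z : Type) := RackAlg.on (free_rack Z).
HB.instance Definition _ (Z : Type) : RackAlg_isRack (free_rack Z) :=
  rack_quot_isRack (@sub_rack_cgr _ _).

Definition free_rack_gen (Z : Type) (z : Z) : free_rack Z :=
  rack_pi _ (RGen z).

Fixpoint rack_eval (Z : Type) (R : rackType) (f : Z -> R) (t : rack_term Z) :
    R :=
  match t with
  | RGen z => f z
  | RAct a b => act (rack_eval f a) (rack_eval f b)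
  | RActV a b => actV (rack_eval f a) (rack_eval f b)
  end.

Definition free_rack_lift_fun (Z : Type) (R : rackType) (f : Z -> R)
    (q : free_rack Z) : R :=
  rack_eval f (qrepr q).

Lemma free_rack_lift_pi (Z : Type) (R : rackType) (f : Z -> R)
    (t : rack_term Z) :
  free_rack_lift_fun f (rack_pi _ t) = rack_eval f t.
Proof.
apply: (rack_cgr_sub_ker (E := @rack_identity _) (f := rack_eval f)) => //.
- by move=> _ _ [a b|a b|a b c] /=; rewrite ?actK ?actVK // act_act.
- exact: (qrepr_pi (rcgr_equiv (rack_cgrP _))).
Qed.

Lemma free_rack_lift_act (Z : Type) (R : rackType) (f : Z -> R)
    (p q : free_rack Z) :
  free_rack_lift_fun f (act p q)
  = act (free_rack_lift_fun f p) (free_rack_lift_fun f q).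
Proof.
have [[a ->] [b ->]] := (rack_pi_surj p, rack_pi_surj q).
by rewrite -rack_pi_act !free_rack_lift_pi.
Qed.

Definition free_rack_lift (Z : Type) (R : rackType) (f : Z -> R) :
    {rackhom free_rack Z -> R} :=
  mk_rackhom (free_rack_lift_act f).

Lemma free_rack_lift_gen (Z : Type) (R : rackType) (f : Z -> R) (z : Z) :
  free_rack_lift f (free_rack_gen z) = f z.
Proof. exact: free_rack_lift_pi. Qed.

Lemma free_rack_ext (Z : Type) (R : rackType)
    (g h : {rackhom free_rack Z -> R}) :
  (forall z, g (free_rack_gen z) = h (free_rack_gen z)) -> g =1 h.
Proof.
move=> gh q; have [t ->] := rack_pi_surj q.
elim: t => [z|a IHa b IHb|a IHa b IHb].
- exact: gh.
- by rewrite [rack_pi _ _](rack_pi_act _ a b) !hom_act IHa IHb.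
- by rewrite [rack_pi _ _](rack_pi_actV _ a b) !hom_actV IHa IHb.
Qed.

Lemma free_rackP (Z : Type) : is_free_rack (@free_rack_gen Z).
Proof.
move=> R f; exists (free_rack_lift f); split; first exact: free_rack_lift_gen.
by move=> h hf; apply: free_rack_ext => z; rewrite hf free_rack_lift_gen.
Qed.

Inductive gl_term (Z : Type) : Type :=
| GGen of Z
| GAct of gl_term Z & gl_term Z
| GActV of gl_term Z & gl_term Z
| GU of gl_term Z
| GUV of gl_term Z.

HB.instance Definition _ (Z : Type) :=
  hasRackOps.Build (gl_term Z) (@GAct Z) (@GActV Z).
HB.instance Definition _ (Z : Type) :=
  hasGLOps.Build (gl_term Z) (@GU Z) (@GUV Z).

Definition free_gl (Z : Type) : Type := gl_quot (@gl_identity (gl_term Z)).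
HB.instance Definition _ (Z : Type) := GLAlg.on (free_gl Z).
HB.instance Definition _ (Z : Type) : RackAlg_isRack (free_gl Z) :=
  gl_quot_isRack (@sub_gl_cgr _ _).
HB.instance Definition _ (Z : Type) : GLAlg_isGLRack (free_gl Z) :=
  gl_quot_isGLRack (@sub_gl_cgr _ _).

Definition free_gl_gen (Z : Type) (z : Z) : free_gl Z := gl_pi _ (GGen z).

Fixpoint gl_eval (Z : Type) (R : glRackType) (f : Z -> R) (t : gl_term Z) : R :=
  match t with
  | GGen z => f z
  | GAct a b => act (gl_eval f a) (gl_eval f b)
  | GActV a b => actV (gl_eval f a) (gl_eval f b)
  | GU a => glu (gl_eval f a)
  | GUV a => gluV (gl_eval f a)
  end.

Definition free_gl_lift_fun (Z : Type) (R : glRackType) (f : Z -> R)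
    (q : free_gl Z) : R :=
  gl_eval f (qrepr q).

Lemma free_gl_lift_pi (Z : Type) (R : glRackType) (f : Z -> R) (t : gl_term Z) :
  free_gl_lift_fun f (gl_pi _ t) = gl_eval f t.
Proof.
apply: (gl_cgr_sub_ker (E := @gl_identity _) (f := gl_eval f)) => //.
- move=> _ _ [_ _ [a b|a b|a b c]|a|a|a b|a b] /=.
  + by rewrite actK.
  + by rewrite actVK.
  + by rewrite act_act.
  + by rewrite gluK.
  + by rewrite gluVK.
  + by rewrite glu_hom.
  + by rewrite glu_act.
- exact: (qrepr_pi (rcgr_equiv (gl_cgrP _))).
Qed.

Lemma free_gl_lift_act (Z : Type) (R : glRackType) (f : Z -> R)
    (p q : free_gl Z) :
  free_gl_lift_fun f (act p q)
  = act (free_gl_lift_fun f p) (free_gl_lift_fun f q).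
Proof.
have [[a ->] [b ->]] := (gl_pi_surj p, gl_pi_surj q).
by rewrite -gl_pi_act !free_gl_lift_pi.
Qed.

Lemma free_gl_lift_glu (Z : Type) (R : glRackType) (f : Z -> R)
    (p : free_gl Z) :
  free_gl_lift_fun f (glu p) = glu (free_gl_lift_fun f p).
Proof.
by have [a ->] := gl_pi_surj p; rewrite -gl_pi_glu !free_gl_lift_pi.
Qed.

Definition free_gl_lift (Z : Type) (R : glRackType) (f : Z -> R) :
    {glhom free_gl Z -> R} :=
  mk_glhom (free_gl_lift_act f) (free_gl_lift_glu f).

Lemma free_gl_lift_gen (Z : Type) (R : glRackType) (f : Z -> R) (z : Z) :
  free_gl_lift f (free_gl_gen z) = f z.
Proof. exact: free_gl_lift_pi. Qed.

Lemma free_gl_ext (Z : Type) (R : glRackType) (g h : {glhom free_gl Z -> R}) :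
  (forall z, g (free_gl_gen z) = h (free_gl_gen z)) -> g =1 h.
Proof.
move=> gh q; have [t ->] := gl_pi_surj q.
elim: t => [z|a IHa b IHb|a IHa b IHb|a IHa|a IHa].
- exact: gh.
- rewrite [gl_pi _ _](gl_pi_act _ a b) !glhom_act; exact: (congr2 _ IHa IHb).
- rewrite [gl_pi _ _](gl_pi_actV _ a b) !glhom_actV; exact: (congr2 _ IHa IHb).
- rewrite [gl_pi _ _](gl_pi_glu _ a) !hom_glu; exact: (congr1 _ IHa).
- rewrite [gl_pi _ _](gl_pi_gluV _ a) !hom_gluV; exact: (congr1 _ IHa).
Qed.

Lemma free_glP (Z : Type) : is_free_gl (@free_gl_gen Z).
Proof.
move=> R f; exists (free_gl_lift f); split; first exact: free_gl_lift_gen.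
by move=> h hf; apply: free_gl_ext => z; rewrite hf free_gl_lift_gen.
Qed.

Inductive tensor_rel (X Y : rackAlgType) (A : rackAlgType) (g : X * Y -> A) :
    A -> A -> Prop :=
| T1_act x y1 y2 :
    tensor_rel g (act (g (x, y2)) (g (x, y1))) (g (x, act y2 y1))
| T1_actV x y1 y2 :
    tensor_rel g (actV (g (x, y2)) (g (x, y1))) (g (x, actV y2 y1))
| T2_act x1 x2 y :
    tensor_rel g (act (g (x2, y)) (g (x1, y))) (g (act x2 x1, y))
| T2_actV x1 x2 y :
    tensor_rel g (actV (g (x2, y)) (g (x1, y))) (g (actV x2 x1, y)).

Lemma rack_identity_rack_cgr (A : rackType) (E : A -> A -> Prop) (a b : A) :
  rack_identity a b -> rack_cgr E a b.
Proof.
have rE := equiv_refl (rack_cgrP E).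
by case=> [x y|x y|x y z]; rewrite ?actK ?actVK // act_act.
Qed.

Definition rack_tensor (R S : rackType) : Type :=
  rack_quot (tensor_rel (@free_rack_gen (R * S))).
HB.instance Definition _ (R S : rackType) := RackAlg.on (rack_tensor R S).
HB.instance Definition _ (R S : rackType) : RackAlg_isRack (rack_tensor R S) :=
  rack_quot_isRack (@rack_identity_rack_cgr (free_rack (R * S)) _).

Definition rack_tens (R S : rackType) (x : R) (y : S) : rack_tensor R S :=
  rack_pi _ (free_rack_gen (x, y)).

Definition rack_tensor_lift_fun (R S T : rackType) (f : R -> S -> T)
    (q : rack_tensor R S) : T :=
  free_rack_lift (fun p => f p.1 p.2) (qrepr q).

Lemma rack_tensor_lift_pi (R S T : rackType) (f : R -> S -> T)
    (fl : forall x y1 y2, f x (act y2 y1) = act (f x y2) (f x y1))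
    (fr : forall x1 x2 y, f (act x2 x1) y = act (f x2 y) (f x1 y))
    (a : free_rack (R * S)) :
  rack_tensor_lift_fun f (rack_pi _ a)
  = free_rack_lift (fun p => f p.1 p.2) a.
Proof.
have := rack_cgr_sub_ker (E := tensor_rel (@free_rack_gen (R * S)))
  (f := free_rack_lift (fun p => f p.1 p.2)).
apply; last exact: (qrepr_pi (rcgr_equiv (rack_cgrP _))).
- exact: hom_act.
- exact: hom_actV.
have flV x y1 y2 : f x (actV y2 y1) = actV (f x y2) (f x y1).
  by rewrite -{2}[y1](actVK y2) fl actK.
have frV x1 x2 y : f (actV x2 x1) y = actV (f x2 y) (f x1 y).
  by rewrite -{2}[x1](actVK x2) fr actK.
move=> _ _ [x y1 y2|x y1 y2|x1 x2 y|x1 x2 y].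
- by rewrite hom_act !free_rack_lift_gen /= fl.
- by rewrite hom_actV !free_rack_lift_gen /= flV.
- by rewrite hom_act !free_rack_lift_gen /= fr.
- by rewrite hom_actV !free_rack_lift_gen /= frV.
Qed.

Lemma rack_tensor_lift_act (R S T : rackType) (f : R -> S -> T)
    (fl : forall x y1 y2, f x (act y2 y1) = act (f x y2) (f x y1))
    (fr : forall x1 x2 y, f (act x2 x1) y = act (f x2 y) (f x1 y))
    (p q : rack_tensor R S) :
  rack_tensor_lift_fun f (act p q)
  = act (rack_tensor_lift_fun f p) (rack_tensor_lift_fun f q).
Proof.
have [[a ->] [b ->]] := (rack_pi_surj p, rack_pi_surj q).
by rewrite -rack_pi_act !rack_tensor_lift_pi // hom_act.
Qed.

Definition rack_tensor_lift (R S T : rackType) (f : R -> S -> T)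
    (fl : forall x y1 y2, f x (act y2 y1) = act (f x y2) (f x y1))
    (fr : forall x1 x2 y, f (act x2 x1) y = act (f x2 y) (f x1 y)) :
    {rackhom rack_tensor R S -> T} :=
  mk_rackhom (rack_tensor_lift_act fl fr).

Lemma rack_tensor_liftE (R S T : rackType) (f : R -> S -> T) fl fr x y :
  @rack_tensor_lift R S T f fl fr (rack_tens x y) = f x y.
Proof. by rewrite [LHS]rack_tensor_lift_pi // free_rack_lift_gen. Qed.

Lemma rack_tensE1 (R S : rackType) (x : R) (y1 y2 : S) :
  rack_tens x (act y2 y1) = act (rack_tens x y2) (rack_tens x y1).
Proof.
by rewrite -rack_pi_act; apply/esym/rack_piP; apply: sub_rack_cgr;
  exact: T1_act.
Qed.

Lemma rack_tensE2 (R S : rackType) (x1 x2 : R) (y : S) :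
  rack_tens (act x2 x1) y = act (rack_tens x2 y) (rack_tens x1 y).
Proof.
by rewrite -rack_pi_act; apply/esym/rack_piP; apply: sub_rack_cgr;
  exact: T2_act.
Qed.

Lemma rack_tensor_ext (R S T : rackType)
    (g h : {rackhom rack_tensor R S -> T}) :
  (forall x y, g (rack_tens x y) = h (rack_tens x y)) -> g =1 h.
Proof.
move=> gh q; have [a ->] := rack_pi_surj q; have [t ->] := rack_pi_surj a.
elim: t => [[x y]|b IHb c IHc|b IHb c IHc].
- exact: gh.
- by rewrite [rack_pi _ (RAct b c)](rack_pi_act _ b c) rack_pi_act !hom_act
    IHb IHc.
- by rewrite [rack_pi _ (RActV b c)](rack_pi_actV _ b c) rack_pi_actV !hom_actV
    IHb IHc.
Qed.

Lemma rack_tensor_map_subproof1 (R R' S S' : rackType) (f : {rackhom R -> R'})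
    (g : {rackhom S -> S'}) (x : R) (y1 y2 : S) :
  rack_tens (f x) (g (act y2 y1))
  = act (rack_tens (f x) (g y2)) (rack_tens (f x) (g y1)).
Proof. by rewrite hom_act rack_tensE1. Qed.

Lemma rack_tensor_map_subproof2 (R R' S S' : rackType) (f : {rackhom R -> R'})
    (g : {rackhom S -> S'}) (x1 x2 : R) (y : S) :
  rack_tens (f (act x2 x1)) (g y)
  = act (rack_tens (f x2) (g y)) (rack_tens (f x1) (g y)).
Proof. by rewrite hom_act rack_tensE2. Qed.

Definition rack_tensor_map (R R' S S' : rackType) (f : {rackhom R -> R'})
    (g : {rackhom S -> S'}) : {rackhom rack_tensor R S -> rack_tensor R' S'} :=
  rack_tensor_lift (f := fun x y => rack_tens (f x) (g y))
    (rack_tensor_map_subproof1 f g) (rack_tensor_map_subproof2 f g).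

Lemma rack_tensor_mapE (R R' S S' : rackType) (f : {rackhom R -> R'})
    (g : {rackhom S -> S'}) (x : R) (y : S) :
  rack_tensor_map f g (rack_tens x y) = rack_tens (f x) (g y).
Proof. exact: rack_tensor_liftE. Qed.

Inductive gl_tensor_rel (X Y : glAlgType) (A : glAlgType) (g : X * Y -> A) :
    A -> A -> Prop :=
| GT_rack a b : tensor_rel g a b -> gl_tensor_rel g a b
| T3_l x y : gl_tensor_rel g (glu (g (x, y))) (g (glu x, y))
| T3_r x y : gl_tensor_rel g (g (glu x, y)) (g (x, glu y)).

Lemma gl_identity_gl_cgr (A : glRackType) (E : A -> A -> Prop) (a b : A) :
  gl_identity a b -> gl_cgr E a b.
Proof.
have rE := equiv_refl (gl_cgrP E); case.
- by move=> _ _ [x y|x y|x y z]; rewrite ?actK ?actVK // act_act.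
- by move=> x; rewrite gluK.
- by move=> x; rewrite gluVK.
- by move=> x y; rewrite glu_hom.
- by move=> x y; rewrite glu_act.
Qed.

Definition gl_tensor (R S : glRackType) : Type :=
  gl_quot (gl_tensor_rel (@free_gl_gen (R * S))).
HB.instance Definition _ (R S : glRackType) := GLAlg.on (gl_tensor R S).
HB.instance Definition _ (R S : glRackType) : RackAlg_isRack (gl_tensor R S) :=
  gl_quot_isRack (@gl_identity_gl_cgr (free_gl (R * S)) _).
HB.instance Definition _ (R S : glRackType) : GLAlg_isGLRack (gl_tensor R S) :=
  gl_quot_isGLRack (@gl_identity_gl_cgr (free_gl (R * S)) _).

Definition gl_tens (R S : glRackType) (x : R) (y : S) : gl_tensor R S :=
  gl_pi _ (free_gl_gen (x, y)).

Definition gl_tensor_lift_fun (R S T : glRackType) (f : R -> S -> T)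
    (q : gl_tensor R S) : T :=
  free_gl_lift (fun p => f p.1 p.2) (qrepr q).

Lemma gl_tensor_lift_pi (R S T : glRackType) (f : R -> S -> T)
    (fl : forall x y1 y2, f x (act y2 y1) = act (f x y2) (f x y1))
    (fr : forall x1 x2 y, f (act x2 x1) y = act (f x2 y) (f x1 y))
    (ful : forall x y, f (glu x) y = glu (f x y))
    (fur : forall x y, f x (glu y) = glu (f x y))
    (a : free_gl (R * S)) :
  gl_tensor_lift_fun f (gl_pi _ a) = free_gl_lift (fun p => f p.1 p.2) a.
Proof.
have := gl_cgr_sub_ker (E := gl_tensor_rel (@free_gl_gen (R * S)))
  (f := free_gl_lift (fun p => f p.1 p.2)).
apply; last exact: (qrepr_pi (rcgr_equiv (gl_cgrP _))).
- exact: glhom_act.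
- exact: glhom_actV.
- exact: hom_glu.
- exact: hom_gluV.
have flV x y1 y2 : f x (actV y2 y1) = actV (f x y2) (f x y1).
  by rewrite -{2}[y1](actVK y2) fl actK.
have frV x1 x2 y : f (actV x2 x1) y = actV (f x2 y) (f x1 y).
  by rewrite -{2}[x1](actVK x2) fr actK.
move=> _ _ [_ _ [x y1 y2|x y1 y2|x1 x2 y|x1 x2 y]|x y|x y].
- by rewrite glhom_act !free_gl_lift_gen /= fl.
- by rewrite glhom_actV !free_gl_lift_gen /= flV.
- by rewrite glhom_act !free_gl_lift_gen /= fr.
- by rewrite glhom_actV !free_gl_lift_gen /= frV.
- by rewrite hom_glu !free_gl_lift_gen /= ful.
- by rewrite !free_gl_lift_gen /= ful fur.
Qed.

Lemma gl_tensor_lift_act (R S T : glRackType) (f : R -> S -> T)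
    (fl : forall x y1 y2, f x (act y2 y1) = act (f x y2) (f x y1))
    (fr : forall x1 x2 y, f (act x2 x1) y = act (f x2 y) (f x1 y))
    (ful : forall x y, f (glu x) y = glu (f x y))
    (fur : forall x y, f x (glu y) = glu (f x y))
    (p q : gl_tensor R S) :
  gl_tensor_lift_fun f (act p q)
  = act (gl_tensor_lift_fun f p) (gl_tensor_lift_fun f q).
Proof.
have [[a ->] [b ->]] := (gl_pi_surj p, gl_pi_surj q).
by rewrite -gl_pi_act !gl_tensor_lift_pi // glhom_act.
Qed.

Lemma gl_tensor_lift_glu (R S T : glRackType) (f : R -> S -> T)
    (fl : forall x y1 y2, f x (act y2 y1) = act (f x y2) (f x y1))
    (fr : forall x1 x2 y, f (act x2 x1) y = act (f x2 y) (f x1 y))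
    (ful : forall x y, f (glu x) y = glu (f x y))
    (fur : forall x y, f x (glu y) = glu (f x y))
    (p : gl_tensor R S) :
  gl_tensor_lift_fun f (glu p) = glu (gl_tensor_lift_fun f p).
Proof.
have [a ->] := gl_pi_surj p.
by rewrite -gl_pi_glu !gl_tensor_lift_pi // hom_glu.
Qed.

Definition gl_tensor_lift (R S T : glRackType) (f : R -> S -> T)
    (fl : forall x y1 y2, f x (act y2 y1) = act (f x y2) (f x y1))
    (fr : forall x1 x2 y, f (act x2 x1) y = act (f x2 y) (f x1 y))
    (ful : forall x y, f (glu x) y = glu (f x y))
    (fur : forall x y, f x (glu y) = glu (f x y)) :
    {glhom gl_tensor R S -> T} :=
  mk_glhom (gl_tensor_lift_act fl fr ful fur)
    (gl_tensor_lift_glu fl fr ful fur).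

Lemma gl_tensor_liftE (R S T : glRackType) (f : R -> S -> T) fl fr ful fur x y :
  @gl_tensor_lift R S T f fl fr ful fur (gl_tens x y) = f x y.
Proof. by rewrite [LHS]gl_tensor_lift_pi // free_gl_lift_gen. Qed.

Lemma gl_tensE1 (R S : glRackType) (x : R) (y1 y2 : S) :
  gl_tens x (act y2 y1) = act (gl_tens x y2) (gl_tens x y1).
Proof.
by rewrite -gl_pi_act; apply/esym/gl_piP; apply: sub_gl_cgr;
  apply: GT_rack; exact: T1_act.
Qed.

Lemma gl_tensE2 (R S : glRackType) (x1 x2 : R) (y : S) :
  gl_tens (act x2 x1) y = act (gl_tens x2 y) (gl_tens x1 y).
Proof.
by rewrite -gl_pi_act; apply/esym/gl_piP; apply: sub_gl_cgr;
  apply: GT_rack; exact: T2_act.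
Qed.

Lemma gl_tensE3l (R S : glRackType) (x : R) (y : S) :
  gl_tens (glu x) y = glu (gl_tens x y).
Proof.
by rewrite -gl_pi_glu; apply/esym/gl_piP; apply: sub_gl_cgr;
  exact: T3_l.
Qed.

Lemma gl_tensE3r (R S : glRackType) (x : R) (y : S) :
  gl_tens x (glu y) = glu (gl_tens x y).
Proof.
by rewrite -gl_tensE3l; apply/esym/gl_piP; apply: sub_gl_cgr;
  exact: T3_r.
Qed.

Lemma gl_tensor_ext (R S T : glRackType) (g h : {glhom gl_tensor R S -> T}) :
  (forall x y, g (gl_tens x y) = h (gl_tens x y)) -> g =1 h.
Proof.
move=> gh q; have [a ->] := gl_pi_surj q; have [t ->] := gl_pi_surj a.
elim: t => [[x y]|b IHb c IHc|b IHb c IHc|b IHb|b IHb].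
- exact: gh.
- rewrite [gl_pi _ (GAct b c)](gl_pi_act _ b c) gl_pi_act !glhom_act;
  exact: (congr2 _ IHb IHc).
- rewrite [gl_pi _ (GActV b c)](gl_pi_actV _ b c) gl_pi_actV !glhom_actV;
  exact: (congr2 _ IHb IHc).
- rewrite [gl_pi _ (GU b)](gl_pi_glu _ b) gl_pi_glu !hom_glu;
  exact: (congr1 _ IHb).
- rewrite [gl_pi _ (GUV b)](gl_pi_gluV _ b) gl_pi_gluV !hom_gluV;
  exact: (congr1 _ IHb).
Qed.

Lemma gl_tensor_map_subproof1 (R R' S S' : glRackType) (f : {glhom R -> R'})
    (g : {glhom S -> S'}) (x : R) (y1 y2 : S) :
  gl_tens (f x) (g (act y2 y1))
  = act (gl_tens (f x) (g y2)) (gl_tens (f x) (g y1)).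
Proof. by rewrite glhom_act gl_tensE1. Qed.

Lemma gl_tensor_map_subproof2 (R R' S S' : glRackType) (f : {glhom R -> R'})
    (g : {glhom S -> S'}) (x1 x2 : R) (y : S) :
  gl_tens (f (act x2 x1)) (g y)
  = act (gl_tens (f x2) (g y)) (gl_tens (f x1) (g y)).
Proof. by rewrite glhom_act gl_tensE2. Qed.

Lemma gl_tensor_map_subproof3 (R R' S S' : glRackType) (f : {glhom R -> R'})
    (g : {glhom S -> S'}) (x : R) (y : S) :
  gl_tens (f (glu x)) (g y) = glu (gl_tens (f x) (g y)).
Proof. by rewrite hom_glu gl_tensE3l. Qed.

Lemma gl_tensor_map_subproof4 (R R' S S' : glRackType) (f : {glhom R -> R'})
    (g : {glhom S -> S'}) (x : R) (y : S) :
  gl_tens (f x) (g (glu y)) = glu (gl_tens (f x) (g y)).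
Proof. by rewrite hom_glu gl_tensE3r. Qed.

Definition gl_tensor_map (R R' S S' : glRackType) (f : {glhom R -> R'})
    (g : {glhom S -> S'}) : {glhom gl_tensor R S -> gl_tensor R' S'} :=
  gl_tensor_lift (f := fun x y => gl_tens (f x) (g y))
    (gl_tensor_map_subproof1 f g) (gl_tensor_map_subproof2 f g)
    (gl_tensor_map_subproof3 f g) (gl_tensor_map_subproof4 f g).

Lemma gl_tensor_mapE (R R' S S' : glRackType) (f : {glhom R -> R'})
    (g : {glhom S -> S'}) (x : R) (y : S) :
  gl_tensor_map f g (gl_tens x y) = gl_tens (f x) (g y).
Proof. exact: gl_tensor_liftE. Qed.

(* The endofunctors are given by their actions on objects and morphisms. *)

Definition rack_nat_iso (F G : rackType -> rackType)
    (Fmap : forall R S, {rackhom R -> S} -> {rackhom F R -> F S})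
    (Gmap : forall R S, {rackhom R -> S} -> {rackhom G R -> G S})
    (eta : forall R, {rackhom F R -> G R}) : Prop :=
  (forall R, rack_iso (eta R)) /\
  (forall R S (f : {rackhom R -> S}),
     eta S \o Fmap R S f =1 Gmap R S f \o eta R).

Definition gl_nat_iso (F G : glRackType -> glRackType)
    (Fmap : forall R S, {glhom R -> S} -> {glhom F R -> F S})
    (Gmap : forall R S, {glhom R -> S} -> {glhom G R -> G S})
    (eta : forall R, {glhom F R -> G R}) : Prop :=
  (forall R, gl_iso (eta R)) /\
  (forall R S (f : {glhom R -> S}),
     eta S \o Fmap R S f =1 Gmap R S f \o eta R).

(* Main.v *)
(* For x in R let ev x : F -> R be the homomorphism sending the generator to x.
   Every value of ev x acts on R as x does, and homomorphisms commute with ev;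
   as s_z is an endomorphism, s_{ev z y} (ev x y) = s_z (ev x y) = ev (s_z x) y.
   So (x, y) |-> ev x y is balanced and induces both isomorphisms; their
   inverses tensor with the generator, since y |-> x (x) y and
   y |-> ev x y (x) generator are homomorphisms agreeing on the generator. *)

Require Import Defs.
From mathcomp Require Import ssreflect ssrfun boolp.

Set Implicit Arguments.
Unset Strict Implicit.
Unset Printing Implicit Defensive.

(** * How the permutation s_a depends on its index a *)

Lemma eq_actV (R : rackType) (a b : R) : act a =1 act b -> actV a =1 actV b.
Proof. by move=> ab z; rewrite -{1}[z](actVK b) -ab actK. Qed.

(** Self-distributivity read as conjugation: s_{s_a(b)} = s_a s_b s_a^{-1}. If s_a and s_b both
    equal s_x, so does this conjugate, which drives the induction in [act_rack_ev]. *)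
Lemma act_act_l (R : rackType) (a b z : R) :
  act (act a b) z = act a (act b (actV a z)).
Proof. by rewrite act_act actVK. Qed.

Lemma act_actV_l (R : rackType) (a b z : R) :
  act (actV a b) z = actV a (act b (act a z)).
Proof. by rewrite -{2}[b](actVK a) -act_act actK. Qed.

(** Being an automorphism, u moves s_a to s_{u(a)}; commuting with s_a, it leaves s_a unchanged. The
    two are compared at u^{-1}(z). *)
Lemma act_glu_l (R : glRackType) (a z : R) : act (glu a) z = act a z.
Proof. by rewrite -{1}[z]gluVK -glu_hom glu_act gluVK. Qed.

Lemma act_gluV_l (R : glRackType) (a z : R) : act (gluV a) z = act a z.
Proof. by rewrite -(act_glu_l (gluV a)) gluVK. Qed.

(** * Bundled composites and endomorphisms *)

Definition rackhom_comp (R S T : rackType) (g : {rackhom S -> T})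
    (f : {rackhom R -> S}) : {rackhom R -> T}.
Proof.
by apply: (@mk_rackhom R T (g \o f)) => x y /=; rewrite !hom_act.
Defined.

Definition glhom_comp (R S T : glRackType) (g : {glhom S -> T})
    (f : {glhom R -> S}) : {glhom R -> T}.
Proof.
apply: (@mk_glhom R T (g \o f)) => [x y|x] /=; first by rewrite !glhom_act.
by rewrite !hom_glu.
Defined.

(** Conversion suffices because [rackhom_comp] is transparent. Later proofs rely on this to display
    a side of an equation as the value of one bundled homomorphism, the form that the extensionality
    lemmas require. *)
Lemma rackhom_compE (R S T : rackType) (g : {rackhom S -> T})
    (f : {rackhom R -> S}) (x : R) :
  rackhom_comp g f x = g (f x).
Proof. by []. Qed.

Definition act_rackhom (R : rackType) (x : R) : {rackhom R -> R} :=
  mk_rackhom (act_act x).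

Lemma glhom_compE (R S T : glRackType) (g : {glhom S -> T})
    (f : {glhom R -> S}) (x : R) :
  glhom_comp g f x = g (f x).
Proof. by []. Qed.

Definition act_glhom (R : glRackType) (x : R) : {glhom R -> R} :=
  mk_glhom (act_act x) (fun y => esym (glu_act x y)).

Definition glu_glhom (R : glRackType) : {glhom R -> R} :=
  mk_glhom (@glu_hom R) (fun=> erefl).

(** * Free racks through their universal property, and evaluation *)

Definition rack_extend (Z : Type) (F : rackType) (i : Z -> F)
    (Fi : is_free_rack i) (R : rackType) (f : Z -> R) : {rackhom F -> R} :=
  sval (cid (Fi R f)).

(** Freeness asserts existence only in [Prop]; [cid] picks the witness, so that extensions can enter
    the definition of the unit maps. *)
Lemma rack_extendE (Z : Type) (F : rackType) (i : Z -> F)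
    (Fi : is_free_rack i) (R : rackType) (f : Z -> R) (z : Z) :
  rack_extend Fi f (i z) = f z.
Proof. exact: (proj1 (svalP (cid (Fi R f)))). Qed.

Lemma is_free_rack_ext (Z : Type) (F : rackType) (i : Z -> F)
    (Fi : is_free_rack i) (R : rackType) (g h : {rackhom F -> R}) :
  (forall z, g (i z) = h (i z)) -> g =1 h.
Proof.
move=> gh y; have [k [_ uk]] := Fi R (fun z => h (i z)).
by rewrite (uk g) // (uk h).
Qed.

(** By uniqueness, as both sides are homomorphisms agreeing on generators. With g = s_x this gives
    [rack_ev_act]; with arbitrary g it gives the naturality of the unit map. *)
Lemma rack_extend_comp (Z : Type) (F : rackType) (i : Z -> F)
    (Fi : is_free_rack i) (R S : rackType) (g : {rackhom R -> S}) (f : Z -> R)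
    (y : F) :
  rack_extend Fi (fun z => g (f z)) y = g (rack_extend Fi f y).
Proof.
rewrite -[RHS]/(rackhom_comp g (rack_extend Fi f) y).
by apply: (is_free_rack_ext Fi) => z; rewrite rackhom_compE !rack_extendE.
Qed.

(** An abstract free rack has no terms to induct on. Its identity factors through the term model
    [free_rack Z], so every element is the value of a term in the generators, and induction runs on
    that term. *)
Lemma is_free_rack_ind (Z : Type) (F : rackType) (i : Z -> F)
    (Fi : is_free_rack i) (P : F -> Prop) :
    (forall z, P (i z)) ->
    (forall a b, P a -> P b -> P (act a b)) ->
    (forall a b, P a -> P b -> P (actV a b)) ->
  forall y, P y.
Proof.
move=> Pi PA PV y.
pose g := rack_extend Fi (@free_rack_gen Z).
have -> : y = free_rack_lift i (g y).
  rewrite -[LHS]/((idfun : {rackhom F -> F}) y).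
  rewrite -[RHS]/(rackhom_comp (free_rack_lift i) g y).
  apply: (is_free_rack_ext Fi) => z.
  by rewrite rackhom_compE rack_extendE free_rack_lift_gen.
have [t ->] := rack_pi_surj (g y).
rewrite [free_rack_lift _ _]free_rack_lift_pi.
by elim: t => [z|a Pa b Pb|a Pa b Pb] /=; [exact: Pi|exact: PA|exact: PV].
Qed.

Definition rack_ev (F : rackType) (i : unit -> F) (Fi : is_free_rack i)
    (R : rackType) (x : R) : {rackhom F -> R} :=
  rack_extend Fi (fun=> x).

Lemma rack_ev_gen (F : rackType) (i : unit -> F) (Fi : is_free_rack i)
    (R : rackType) (x : R) :
  rack_ev Fi x (i tt) = x.
Proof. exact: rack_extendE. Qed.

Lemma rack_ev_hom (F : rackType) (i : unit -> F) (Fi : is_free_rack i)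
    (R S : rackType) (g : {rackhom R -> S}) (x : R) (y : F) :
  rack_ev Fi (g x) y = g (rack_ev Fi x y).
Proof. exact: rack_extend_comp. Qed.

Lemma act_rack_ev (F : rackType) (i : unit -> F) (Fi : is_free_rack i)
    (R : rackType) (x : R) (y : F) (z : R) :
  act (rack_ev Fi x y) z = act x z.
Proof.
(* The point z stays general, since conjugation uses the induction hypotheses at other points. *)
move: y z; apply: (is_free_rack_ind Fi) => [[]|a b IHa IHb|a b IHa IHb] z.
- by rewrite rack_ev_gen.
- by rewrite hom_act act_act_l IHa IHb (eq_actV IHa) actVK.
- by rewrite hom_actV act_actV_l IHa IHb (eq_actV IHa) actK.
Qed.

Lemma rack_ev_act (F : rackType) (i : unit -> F) (Fi : is_free_rack i)
    (R : rackType) (x1 x2 : R) (y : F) :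
  rack_ev Fi (act x2 x1) y = act (rack_ev Fi x2 y) (rack_ev Fi x1 y).
Proof. by rewrite act_rack_ev (rack_ev_hom Fi (act_rackhom x2)). Qed.

(** * Free GL-racks through their universal property, and evaluation *)

Definition gl_extend (Z : Type) (F : glRackType) (i : Z -> F)
    (Fi : is_free_gl i) (R : glRackType) (f : Z -> R) : {glhom F -> R} :=
  sval (cid (Fi R f)).

Lemma gl_extendE (Z : Type) (F : glRackType) (i : Z -> F)
    (Fi : is_free_gl i) (R : glRackType) (f : Z -> R) (z : Z) :
  gl_extend Fi f (i z) = f z.
Proof. exact: (proj1 (svalP (cid (Fi R f)))). Qed.

Lemma is_free_gl_ext (Z : Type) (F : glRackType) (i : Z -> F)
    (Fi : is_free_gl i) (R : glRackType) (g h : {glhom F -> R}) :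
  (forall z, g (i z) = h (i z)) -> g =1 h.
Proof.
move=> gh y; have [k [_ uk]] := Fi R (fun z => h (i z)).
by rewrite (uk g) // (uk h).
Qed.

Lemma gl_extend_comp (Z : Type) (F : glRackType) (i : Z -> F)
    (Fi : is_free_gl i) (R S : glRackType) (g : {glhom R -> S}) (f : Z -> R)
    (y : F) :
  gl_extend Fi (fun z => g (f z)) y = g (gl_extend Fi f y).
Proof.
rewrite -[RHS]/(glhom_comp g (gl_extend Fi f) y).
by apply: (is_free_gl_ext Fi) => z; rewrite glhom_compE !gl_extendE.
Qed.

Lemma is_free_gl_ind (Z : Type) (F : glRackType) (i : Z -> F)
    (Fi : is_free_gl i) (P : F -> Prop) :
    (forall z, P (i z)) ->
    (forall a b, P a -> P b -> P (act a b)) ->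
    (forall a b, P a -> P b -> P (actV a b)) ->
    (forall a, P a -> P (glu a)) ->
    (forall a, P a -> P (gluV a)) ->
  forall y, P y.
Proof.
move=> Pi PA PV Pu PuV y.
pose g := gl_extend Fi (@free_gl_gen Z).
have -> : y = free_gl_lift i (g y).
  rewrite -[LHS]/((idfun : {glhom F -> F}) y).
  rewrite -[RHS]/(glhom_comp (free_gl_lift i) g y).
  apply: (is_free_gl_ext Fi) => z.
  by rewrite glhom_compE gl_extendE free_gl_lift_gen.
have [t ->] := gl_pi_surj (g y).
rewrite [free_gl_lift _ _]free_gl_lift_pi.
elim: t => [z|a Pa b Pb|a Pa b Pb|a Pa|a Pa] /=.
- exact: Pi.
- exact: PA.
- exact: PV.
- exact: Pu.
- exact: PuV.
Qed.

Definition gl_ev (F : glRackType) (i : unit -> F) (Fi : is_free_gl i)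
    (R : glRackType) (x : R) : {glhom F -> R} :=
  gl_extend Fi (fun=> x).

Lemma gl_ev_gen (F : glRackType) (i : unit -> F) (Fi : is_free_gl i)
    (R : glRackType) (x : R) :
  gl_ev Fi x (i tt) = x.
Proof. exact: gl_extendE. Qed.

Lemma gl_ev_hom (F : glRackType) (i : unit -> F) (Fi : is_free_gl i)
    (R S : glRackType) (g : {glhom R -> S}) (x : R) (y : F) :
  gl_ev Fi (g x) y = g (gl_ev Fi x y).
Proof. exact: gl_extend_comp. Qed.

(** Beyond the conjugation cases, u and u^{-1} are harmless because s_{u(a)} = s_a. *)
Lemma act_gl_ev (F : glRackType) (i : unit -> F) (Fi : is_free_gl i)
    (R : glRackType) (x : R) (y : F) (z : R) :
  act (gl_ev Fi x y) z = act x z.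
Proof.
move: y z.
apply: (is_free_gl_ind Fi) => [[]|a b IHa IHb|a b IHa IHb|a IH|a IH] z.
- by rewrite gl_ev_gen.
- by rewrite glhom_act act_act_l IHa IHb (eq_actV IHa) actVK.
- by rewrite glhom_actV act_actV_l IHa IHb (eq_actV IHa) actK.
- by rewrite hom_glu act_glu_l.
- by rewrite hom_gluV act_gluV_l.
Qed.

(** Since u is itself a GL-rack endomorphism of R, this is an instance of the compatibility of
    evaluation with homomorphisms. *)
Lemma gl_ev_glu (F : glRackType) (i : unit -> F) (Fi : is_free_gl i)
    (R : glRackType) (x : R) (y : F) :
  gl_ev Fi (glu x) y = glu (gl_ev Fi x y).
Proof. exact: (gl_ev_hom Fi (glu_glhom R)). Qed.

Lemma gl_ev_act (F : glRackType) (i : unit -> F) (Fi : is_free_gl i)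
    (R : glRackType) (x1 x2 : R) (y : F) :
  gl_ev Fi (act x2 x1) y = act (gl_ev Fi x2 y) (gl_ev Fi x1 y).
Proof. by rewrite act_gl_ev (gl_ev_hom Fi (act_glhom x2)). Qed.

(** * Tensoring with a fixed element, and the unit maps *)

Definition rack_tensor_genr (R F : rackType) (e : F) :
    {rackhom R -> rack_tensor R F} :=
  @mk_rackhom R (rack_tensor R F) (fun x => rack_tens x e)
    (fun x1 x2 => rack_tensE2 x2 x1 e).

(** Here and in [rack_tensor_genr] the element [e] is arbitrary: the generator gives the inverse of
    a unit map, while a general x of R gives the homomorphism compared with it in [rack_unitrK] and
    [rack_unitlK]. *)
Definition rack_tensor_genl (F R : rackType) (e : F) :
    {rackhom R -> rack_tensor F R} :=
  @mk_rackhom R (rack_tensor F R) (rack_tens e)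
    (fun x1 x2 => rack_tensE1 e x2 x1).

Definition gl_tensor_genr (R F : glRackType) (e : F) :
    {glhom R -> gl_tensor R F} :=
  @mk_glhom R (gl_tensor R F) (fun x => gl_tens x e)
    (fun x1 x2 => gl_tensE2 x2 x1 e) (fun x => gl_tensE3l x e).

Definition gl_tensor_genl (F R : glRackType) (e : F) :
    {glhom R -> gl_tensor F R} :=
  @mk_glhom R (gl_tensor F R) (gl_tens e)
    (fun x1 x2 => gl_tensE1 e x2 x1) (fun x => gl_tensE3r e x).

Definition rack_unitr (F : rackType) (i : unit -> F) (Fi : is_free_rack i)
    (R : rackType) : {rackhom rack_tensor R F -> R} :=
  rack_tensor_lift (f := fun x y => rack_ev Fi x y)
    (fun x y1 y2 => @hom_act _ _ (rack_ev Fi x) y2 y1) (@rack_ev_act F i Fi R).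

Definition rack_unitl (F : rackType) (i : unit -> F) (Fi : is_free_rack i)
    (R : rackType) : {rackhom rack_tensor F R -> R} :=
  rack_tensor_lift (f := fun y x => rack_ev Fi x y)
    (fun y x1 x2 => rack_ev_act Fi x1 x2 y)
    (fun y1 y2 x => @hom_act _ _ (rack_ev Fi x) y2 y1).

Definition gl_unitr (F : glRackType) (i : unit -> F) (Fi : is_free_gl i)
    (R : glRackType) : {glhom gl_tensor R F -> R} :=
  gl_tensor_lift (f := fun x y => gl_ev Fi x y)
    (fun x y1 y2 => @glhom_act _ _ (gl_ev Fi x) y2 y1) (@gl_ev_act F i Fi R)
    (@gl_ev_glu F i Fi R) (fun x => @hom_glu _ _ (gl_ev Fi x)).

Definition gl_unitl (F : glRackType) (i : unit -> F) (Fi : is_free_gl i)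
    (R : glRackType) : {glhom gl_tensor F R -> R} :=
  gl_tensor_lift (f := fun y x => gl_ev Fi x y)
    (fun y x1 x2 => gl_ev_act Fi x1 x2 y)
    (fun y1 y2 x => @glhom_act _ _ (gl_ev Fi x) y2 y1)
    (fun y x => @hom_glu _ _ (gl_ev Fi x) y) (fun y x => gl_ev_glu Fi x y).

(** * Inverses and naturality for racks *)

Lemma rack_unitr_genK (F : rackType) (i : unit -> F) (Fi : is_free_rack i)
    (R : rackType) :
  cancel (rack_tensor_genr R (i tt)) (rack_unitr Fi R).
Proof. by move=> x; rewrite [LHS]rack_tensor_liftE rack_ev_gen. Qed.

Lemma rack_unitrK (F : rackType) (i : unit -> F) (Fi : is_free_rack i)
    (R : rackType) :
  cancel (rack_unitr Fi R) (rack_tensor_genr R (i tt)).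
Proof.
move=> q.
rewrite -[RHS]/((idfun : {rackhom rack_tensor R F -> rack_tensor R F}) q).
rewrite -[LHS]/(rackhom_comp (rack_tensor_genr R (i tt)) (rack_unitr Fi R) q).
apply: rack_tensor_ext => x y; rewrite rackhom_compE rack_tensor_liftE.
(* It remains to move y across the tensor sign. For fixed x, both sides are homomorphisms in y: the
   left one by (T2) after [rack_ev], the right one by (T1). *)
rewrite -[LHS]/(rackhom_comp (rack_tensor_genr R (i tt)) (rack_ev Fi x) y).
rewrite -[RHS]/(rack_tensor_genl F x y).
by apply: (is_free_rack_ext Fi) => -[]; rewrite rackhom_compE rack_ev_gen.
Qed.

Lemma rack_unitl_genK (F : rackType) (i : unit -> F) (Fi : is_free_rack i)
    (R : rackType) :
  cancel (rack_tensor_genl R (i tt)) (rack_unitl Fi R).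
Proof. by move=> x; rewrite [LHS]rack_tensor_liftE rack_ev_gen. Qed.

Lemma rack_unitlK (F : rackType) (i : unit -> F) (Fi : is_free_rack i)
    (R : rackType) :
  cancel (rack_unitl Fi R) (rack_tensor_genl R (i tt)).
Proof.
move=> q.
rewrite -[RHS]/((idfun : {rackhom rack_tensor F R -> rack_tensor F R}) q).
rewrite -[LHS]/(rackhom_comp (rack_tensor_genl R (i tt)) (rack_unitl Fi R) q).
apply: rack_tensor_ext => y x; rewrite rackhom_compE rack_tensor_liftE.
rewrite -[LHS]/(rackhom_comp (rack_tensor_genl R (i tt)) (rack_ev Fi x) y).
rewrite -[RHS]/(rack_tensor_genr F x y).
by apply: (is_free_rack_ext Fi) => -[]; rewrite rackhom_compE rack_ev_gen.
Qed.

Lemma rack_unitr_nat (F : rackType) (i : unit -> F) (Fi : is_free_rack i)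
    (R S : rackType) (f : {rackhom R -> S}) :
  rack_unitr Fi S \o rack_tensor_map f idfun =1 f \o rack_unitr Fi R.
Proof.
move=> q.
rewrite -[LHS]/(rackhom_comp (rack_unitr Fi S) (rack_tensor_map f idfun) q).
rewrite -[RHS]/(rackhom_comp f (rack_unitr Fi R) q).
(* On x (x) y the square compares evaluation at f(x) with f after evaluation at x. *)
apply: rack_tensor_ext => x y.
by rewrite !rackhom_compE rack_tensor_mapE !rack_tensor_liftE rack_ev_hom.
Qed.

(** * Inverses and naturality for GL-racks *)

Lemma gl_unitr_genK (F : glRackType) (i : unit -> F) (Fi : is_free_gl i)
    (R : glRackType) :
  cancel (gl_tensor_genr R (i tt)) (gl_unitr Fi R).
Proof. by move=> x; rewrite [LHS]gl_tensor_liftE gl_ev_gen. Qed.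

Lemma gl_unitrK (F : glRackType) (i : unit -> F) (Fi : is_free_gl i)
    (R : glRackType) :
  cancel (gl_unitr Fi R) (gl_tensor_genr R (i tt)).
Proof.
move=> q.
rewrite -[RHS]/((idfun : {glhom gl_tensor R F -> gl_tensor R F}) q).
rewrite -[LHS]/(glhom_comp (gl_tensor_genr R (i tt)) (gl_unitr Fi R) q).
apply: gl_tensor_ext => x y; rewrite glhom_compE gl_tensor_liftE.
rewrite -[LHS]/(glhom_comp (gl_tensor_genr R (i tt)) (gl_ev Fi x) y).
rewrite -[RHS]/(gl_tensor_genl F x y).
by apply: (is_free_gl_ext Fi) => -[]; rewrite glhom_compE gl_ev_gen.
Qed.

Lemma gl_unitl_genK (F : glRackType) (i : unit -> F) (Fi : is_free_gl i)
    (R : glRackType) :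
  cancel (gl_tensor_genl R (i tt)) (gl_unitl Fi R).
Proof. by move=> x; rewrite [LHS]gl_tensor_liftE gl_ev_gen. Qed.

Lemma gl_unitlK (F : glRackType) (i : unit -> F) (Fi : is_free_gl i)
    (R : glRackType) :
  cancel (gl_unitl Fi R) (gl_tensor_genl R (i tt)).
Proof.
move=> q.
rewrite -[RHS]/((idfun : {glhom gl_tensor F R -> gl_tensor F R}) q).
rewrite -[LHS]/(glhom_comp (gl_tensor_genl R (i tt)) (gl_unitl Fi R) q).
apply: gl_tensor_ext => y x; rewrite glhom_compE gl_tensor_liftE.
rewrite -[LHS]/(glhom_comp (gl_tensor_genl R (i tt)) (gl_ev Fi x) y).
rewrite -[RHS]/(gl_tensor_genr F x y).
by apply: (is_free_gl_ext Fi) => -[]; rewrite glhom_compE gl_ev_gen.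
Qed.

Lemma gl_unitr_nat (F : glRackType) (i : unit -> F) (Fi : is_free_gl i)
    (R S : glRackType) (f : {glhom R -> S}) :
  gl_unitr Fi S \o gl_tensor_map f idfun =1 f \o gl_unitr Fi R.
Proof.
move=> q.
rewrite -[LHS]/(glhom_comp (gl_unitr Fi S) (gl_tensor_map f idfun) q).
rewrite -[RHS]/(glhom_comp f (gl_unitr Fi R) q).
apply: gl_tensor_ext => x y.
by rewrite !glhom_compE gl_tensor_mapE !gl_tensor_liftE gl_ev_hom.
Qed.

Theorem theorem6p9 :
  (forall (F : rackType) (i : unit -> F), is_free_rack i ->
     (exists eta : forall R : rackType, {rackhom rack_tensor R F -> R},
        rack_nat_iso (F := fun R => rack_tensor R F) (G := fun R => R)
          (fun R S f => rack_tensor_map f idfun) (fun R S f => f) eta) /\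
     (exists theta : forall R : rackType, {rackhom R -> rack_tensor F R},
        rack_nat_iso (F := fun R => R) (G := fun R => rack_tensor F R)
          (fun R S f => f) (fun R S f => rack_tensor_map idfun f) theta)) /\
  (forall (L : glRackType) (i : unit -> L), is_free_gl i ->
     (exists eta : forall R : glRackType, {glhom gl_tensor R L -> R},
        gl_nat_iso (F := fun R => gl_tensor R L) (G := fun R => R)
          (fun R S f => gl_tensor_map f idfun) (fun R S f => f) eta) /\
     (exists theta : forall R : glRackType, {glhom R -> gl_tensor L R},
        gl_nat_iso (F := fun R => R) (G := fun R => gl_tensor L R)
          (fun R S f => f) (fun R S f => gl_tensor_map idfun f) theta)).
Proof.
split=> [F i Fi|L i Li].
(* The second isomorphism starts from R, so its witness is tensoring with the generator rather than
   [rack_unitl]. Its naturality is then immediate, because the identity of F fixes the generator. *)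
- split; [exists (rack_unitr Fi)|exists (fun R => rack_tensor_genl R (i tt))].
  + split; last by move=> R S f; exact: rack_unitr_nat.
    by move=> R; exists (rack_tensor_genr R (i tt)); split;
      [exact: rack_unitrK|exact: rack_unitr_genK].
  + split; last by move=> R S f x; exact/esym/rack_tensor_mapE.
    by move=> R; exists (rack_unitl Fi R); split;
      [exact: rack_unitl_genK|exact: rack_unitlK].
- split; [exists (gl_unitr Li)|exists (fun R => gl_tensor_genl R (i tt))].
  + split; last by move=> R S f; exact: gl_unitr_nat.
    by move=> R; exists (gl_tensor_genr R (i tt)); split;
      [exact: gl_unitrK|exact: gl_unitr_genK].
  + split; last by move=> R S f x; exact/esym/gl_tensor_mapE.
    by move=> R; exists (gl_unitl Li R); split;
      [exact: gl_unitl_genK|exact: gl_unitlK].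
Qed.
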